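(* We have $$8.4199\leq\lim_{n\to\infty}|s^{-1}(\mathrm{Av}_n(321))|^{1/n}\leq 11.6569.$$
   Context: $S_n$ is the set of permutations of $\{1,\ldots,n\}$, written as words. The stack-sorting map $s$ is defined recursively on words of distinct positive integers: $s$ sends the empty word to itself, and if $\pi=LNR$ where $N$ is the largest entry of $\pi$, then $s(\pi)=s(L)s(R)N$. Thus $s$ maps $S_n$ to $S_n$, and $s^{-1}(A)=\{\sigma\in S_n: s(\sigma)\in A\}$ for $A\subseteq S_n$. $\mathrm{Av}_n(321)$ is the set of permutations in $S_n$ avoiding (in the classical sense) the pattern $321$. The limit in the claim exists. *)

(* Defs.v *)
From mathcomp Require Import all_boot all_order all_algebra.
From mathcomp Require Import all_classical all_reals all_analysis.
Set Implicit Arguments.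
Unset Strict Implicit.
Unset Printing Implicit Defensive.

(* Permutations of {1, ..., n} as words: the n! rearrangements, without
   repetition, of [:: 1; 2; ...; n]. *)
Definition Sn (n : nat) : seq (seq nat) := permutations (iota 1 n).

Lemma Sn_uniq n : uniq (Sn n).
Proof. exact: permutations_uniq. Qed.

Lemma mem_Sn n w : (w \in Sn n) = perm_eq w (iota 1 n).
Proof. exact: mem_permutations. Qed.

Definition max_entry (w : seq nat) : nat := foldr maxn 0 w.

(* The first argument bounds the recursion depth; any value at least size w
   gives the same result. The defining recursion is stack_sortE below. *)
Fixpoint stack_sort_rec (k : nat) (w : seq nat) : seq nat :=
  match k, w with
  | k'.+1, _ :: _ =>
      let N := max_entry w in
      let i := index N w in
      stack_sort_rec k' (take i w) ++ stack_sort_rec k' (drop i.+1 w) ++ [:: N]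
  | _, _ => [::]
  end.

Definition stack_sort (w : seq nat) : seq nat := stack_sort_rec (size w) w.

Lemma max_entry_ge w x : x \in w -> x <= max_entry w.
Proof.
elim: w => //= a w IHw; rewrite in_cons leq_max => /predU1P[->|/IHw->].
  by rewrite leqnn.
by rewrite orbT.
Qed.

Lemma max_entry_mem w : w != [::] -> max_entry w \in w.
Proof.
elim: w => //= a [|b w] IHw _; first by rewrite /= maxn0 inE.
rewrite in_cons /maxn; case: ifP => _; last by rewrite eqxx.
by rewrite IHw ?orbT.
Qed.

Lemma stack_sort_recS k w (N := max_entry w) (i := index N w) :
  w != [::] ->
  stack_sort_rec k.+1 w =
    stack_sort_rec k (take i w) ++ stack_sort_rec k (drop i.+1 w) ++ [:: N].
Proof. by rewrite /i /N; case: w {N i}. Qed.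

Lemma stack_sort_rec_stable k w :
  size w <= k -> stack_sort_rec k w = stack_sort w.
Proof.
suff stable k1 k2 v : size v <= k1 -> size v <= k2 ->
    stack_sort_rec k1 v = stack_sort_rec k2 v.
  by move=> lewk; apply: stable.
elim: k1 k2 v => [|k1 IHk] [|k2] v; try by case: v.
have [->//|v_neq0 le1 le2] := eqVneq v [::].
rewrite !stack_sort_recS //; set i := index _ _.
have lti : i < size v by rewrite index_mem max_entry_mem.
have shorter j : size v <= j.+1 ->
    (size (take i v) <= j) * (size (drop i.+1 v) <= j).
  move=> lek; rewrite size_drop size_take lti; split.
    by rewrite -ltnS (leq_trans lti).
  by rewrite leq_subLR addSn -addnS (leq_trans lek) ?leq_addl.
have [t1 d1] := shorter _ le1; have [t2 d2] := shorter _ le2.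
by congr (_ ++ (_ ++ _)); apply: IHk.
Qed.

Lemma stack_sort_nil : stack_sort [::] = [::].
Proof. by []. Qed.

Lemma stack_sortE (L R : seq nat) (N : nat) :
  {in L ++ R, forall x, x < N} ->
  stack_sort (L ++ N :: R) = stack_sort L ++ stack_sort R ++ [:: N].
Proof.
move=> ltN; set w := L ++ N :: R.
have w_neq0 : w != [::] by rewrite /w; case: (L).
have Nw : N \in w by rewrite mem_cat mem_head orbT.
have maxw : max_entry w = N.
  apply/eqP; rewrite eqn_leq max_entry_ge // andbT.
  have := max_entry_mem w_neq0; move: (max_entry w) => M.
  rewrite mem_cat in_cons orbCA -mem_cat.
  by case/predU1P=> [->|/ltN ltMN]; last exact: ltnW.
have NL : N \notin L.
  by apply/negP=> NL; have := ltN N; rewrite mem_cat NL ltnn => /(_ isT).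
have idx : index N w = size L by rewrite index_cat (negPf NL) /= eqxx addn0.
have szw : size w = (size L + size R).+1 by rewrite size_cat /= addnS.
rewrite {1}/stack_sort szw stack_sort_recS // maxw idx take_size_cat //.
have -> : drop (size L).+1 w = R.
  by rewrite /w -cat_rcons drop_size_cat ?size_rcons.
rewrite (stack_sort_rec_stable (leq_addr _ _)).
by rewrite (stack_sort_rec_stable (leq_addl _ _)).
Qed.

Lemma perm_stack_sort w : perm_eq (stack_sort w) w.
Proof.
have [k] := ubnP (size w); elim: k w => // k IHk w ltwk.
have [->//|w_neq0] := eqVneq w [::].
set N := max_entry w; set i := index N w.
have Nw : N \in w by apply: max_entry_mem.
have lti : i < size w by rewrite index_mem.
rewrite -(stack_sort_rec_stable (leqnSn _)) stack_sort_recS // -/N -/i.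
have szt : size (take i w) < size w by rewrite size_take lti.
have szd : size (drop i.+1 w) < size w.
  by rewrite size_drop ltn_subrL (leq_ltn_trans _ lti).
rewrite (stack_sort_rec_stable (ltnW szt)) (stack_sort_rec_stable (ltnW szd)).
have def_w : w = take i w ++ [:: N] ++ drop i.+1 w.
  by rewrite -{1}(cat_take_drop i w) (drop_nth 0 lti) nth_index.
rewrite [X in perm_eq _ X]def_w.
have permL := IHk _ (leq_trans szt ltwk).
have permR := IHk _ (leq_trans szd ltwk).
by apply: perm_cat permL _; rewrite perm_catC perm_cat2l.
Qed.

Lemma stack_sort_Sn n w : w \in Sn n -> stack_sort w \in Sn n.
Proof. by rewrite !mem_Sn; apply: perm_trans (perm_stack_sort w). Qed.

(* Words u and v of distinct entries have the same relative order. *)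
Definition order_isomorphic (u v : seq nat) : bool :=
  (size u == size v) &&
  [forall i : 'I_(size u), forall j : 'I_(size u),
     (nth 0 u i < nth 0 u j) == (nth 0 v i < nth 0 v j)].

(* Classical containment: mask m w ranges over the subsequences of w. *)
Definition contains_pattern (w p : seq nat) : bool :=
  [exists m : (size w).-tuple bool, order_isomorphic (mask m w) p].

Definition Av (n : nat) (p : seq nat) : seq (seq nat) :=
  [seq w <- Sn n | ~~ contains_pattern w p].

Definition stack_sort_preim (n : nat) (A : seq (seq nat)) : seq (seq nat) :=
  [seq w <- Sn n | stack_sort w \in A].

Lemma stack_sort_preim_uniq n A : uniq (stack_sort_preim n A).
Proof. by rewrite filter_uniq ?Sn_uniq. Qed.

Local Open Scope ring_scope.

(* The exponent at n = 0 is 0^-1 = 0, which does not affect the limit. *)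
Definition root_card_preim_Av321 (R : realType) (n : nat) : R :=
  (size (stack_sort_preim n (Av n [:: 3; 2; 1]%N)))%:R `^ n%:R^-1.

(* Main.v *)
(* A preimage of a 321-avoiding permutation p is a decreasing binary tree with
   postorder word p, so it is determined by the shape of the tree, read as the
   sequence of node types in postorder, together with the jumps of the running
   maximum of p: the other entries of p are forced to increase.

   Upper bound. A non-record preceded by a record is smaller than its
   predecessor, hence a leaf. Counting the words of jumps and types with this
   constraint by a weighted 2-state transfer matrix gives the growth rate
   4 u + 6 + 2 / u for every leaf weight u; the minimum is 6 + 4 sqrt 2.

   Lower bound. Conversely, a word whose stack machine never underflows and
   whose non-records are leaves, or unary nodes over a non-record, comes from
   a preimage. These words form an automaton on (unused values, pending
   subtrees), and a finite truncation of it has growth rate above 17 / 2.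

   Limit. Direct sums of preimages are preimages, so the counts are
   supermultiplicative and Fekete's lemma applies. *)
Require Import Defs.
From mathcomp Require Import all_boot all_order all_algebra.
From mathcomp Require Import all_classical all_reals all_analysis.
From mathcomp Require Import zify ring lra.
Import Order.TTheory GRing.Theory Num.Theory numFieldNormedType.Exports.
Set Implicit Arguments.
Unset Strict Implicit.
Unset Printing Implicit Defensive.

(** * Avoidance of 321, read from left to right *)

Lemma contains_321P (w : seq nat) :
  reflect (exists a b c, [/\ subseq [:: a; b; c] w, b < a & c < b])
          (contains_pattern w [:: 3; 2; 1]).
Proof.
apply: (iffP existsP) => [[m]|[a [b [c [abc_w ltba ltcb]]]]].
  have := mask_subseq m w; move: (mask m w) => v sub_vw /andP[/eqP/= szv].
  case: v szv sub_vw => [|a [|b [|c []]]] //= _ abc_w /forallP iso.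
  have /forallP/(_ ord0)/eqP/= ba := iso (Ordinal (isT : 1 < 3)).
  have /forallP/(_ (Ordinal (isT : 1 < 3)))/eqP/= cb :=
    iso (Ordinal (isT : 2 < 3)).
  by exists a, b, c; split; rewrite ?ba ?cb.
have /subseqP[m szm def_v] := abc_w.
exists (Tuple (introT eqP szm)) => /=; rewrite -def_v /order_isomorphic /=.
have ltca := ltn_trans ltcb ltba.
apply/forallP=> -[[|[|[|i]]] lti] //=; apply/forallP=> -[[|[|[|j]]] ltj] //=;
  by apply/eqP; rewrite /= ?ltnn ?ltba ?ltcb ?ltca // ltnNge ltnW.
Qed.

(* [m] is the largest entry already read: an entry below it must not be
   followed by a smaller one. *)
Fixpoint avoids321 (m : nat) (w : seq nat) : bool :=
  if w is x :: w' then
    ((x < m) ==> all (leq x) w') && avoids321 (maxn m x) w'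
  else true.

Lemma subseq_cons2 (T : eqType) (a x : T) (u s : seq T) :
  subseq (a :: u) (x :: s) = (a == x) && subseq u s || subseq (a :: u) s.
Proof.
rewrite [LHS]/=; case: eqP => //= _; case sub_us: (subseq u s) => //=.
by apply/esym/negP => /(subseq_trans (subseq_cons u a)); rewrite sub_us.
Qed.

(** Only the largest entry read so far matters as the top of a 321 pattern, so the single entry [m]
    stands for the whole prefix. *)
Lemma avoids321P m w :
  reflect (forall a b c, subseq [:: a; b; c] (m :: w) -> b < a -> b <= c)
          (avoids321 m w).
Proof.
elim: w m => [|x w IHw] m.
  by apply: ReflectT => a b c; rewrite subseq_cons2 /= andbF.
apply: (iffP andP) => [[/implyP xw /IHw avw] a b c | av].
  rewrite subseq_cons2 [subseq [:: b; c] _]subseq_cons2 sub1seq.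
  case/orP=> [/andP[/eqP-> /orP[/andP[/eqP-> cw] ltxm | bcw ltbm]] | abc ltba].
  - exact: (allP (xw ltxm)).
  - apply: (avw (maxn m x)); first by rewrite subseq_cons2 eqxx bcw.
    by rewrite leq_max ltbm.
  - move: abc; rewrite subseq_cons2 => /orP[/andP[/eqP def_a bcw] | abc].
      apply: (avw (maxn m x)); first by rewrite subseq_cons2 eqxx bcw.
      by rewrite leq_max -def_a ltba orbT.
    by apply: (avw a) => //; rewrite subseq_cons2 abc orbT.
split.
  apply/implyP => ltxm; apply/allP => c cw; apply: (av m) => //.
  by rewrite subseq_cons2 eqxx subseq_cons2 eqxx sub1seq cw.
apply/IHw => a b c; rewrite subseq_cons2 => /orP[/andP[/eqP-> bcw] | abcw] ltba.
  case: (leqP x m) ltba => _ ltb; first apply: (av m) => //.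
    by rewrite subseq_cons2 eqxx subseq_cons2 bcw orbT.
  by apply: (av x) => //; rewrite subseq_cons2 (subseq_cons2 x x) eqxx bcw !orbT.
by apply: (av a) => //; rewrite !(subseq_cons2 a) abcw !orbT.
Qed.

Lemma avoids321E w : avoids321 0 w = ~~ contains_pattern w [:: 3; 2; 1].
Proof.
apply/idP/negP => [/avoids321P av | av].
  move=> /contains_321P[a [b [c [abc ltba]]]].
  by apply/negP; rewrite -leqNgt (av a) // subseq_cons2 abc orbT.
apply/avoids321P => a b c.
rewrite subseq_cons2 => /orP[/andP[/eqP->] // | abc] ltba.
rewrite leqNgt; apply/negP => ltcb; apply: av; apply/contains_321P.
by exists a, b, c.
Qed.

Definition preim321 (n : nat) : seq (seq nat) :=
  stack_sort_preim n (Av n [:: 3; 2; 1]).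

Lemma mem_preim321 n w :
  (w \in preim321 n) = perm_eq w (iota 1 n) && avoids321 0 (stack_sort w).
Proof.
rewrite mem_filter andbC mem_Sn mem_filter -avoids321E.
by apply: andb_id2l; rewrite -mem_Sn => /stack_sort_Sn->; rewrite andbT.
Qed.

(** * Direct sums of preimages *)

Lemma split_max (w : seq nat) : w != [::] -> uniq w ->
  exists (L : seq nat) (N : nat) (R : seq nat),
    w = L ++ N :: R /\ {in L ++ R, forall x, x < N}.
Proof.
move=> w_neq0 Uw; have Nw := max_entry_mem w_neq0; set N := max_entry w in Nw.
case/splitPr def_w: {-}w / Nw => [L R]; exists L, N, R; split=> // x LRx.
have xw : x \in w by rewrite def_w mem_cat inE orbCA -mem_cat LRx orbT.
rewrite ltn_neqAle max_entry_ge // andbT; apply: contraTneq LRx => ->.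
by move: Uw; rewrite def_w -cat1s uniq_catCA cat1s /= => /andP[].
Qed.

(** The maximum of [u ++ v] lies in [v], so removing it leaves [u] whole at the left end. *)
Lemma stack_sort_cat (u v : seq nat) :
  {in u & v, forall x y, x < y} -> uniq v ->
  stack_sort (u ++ v) = stack_sort u ++ stack_sort v.
Proof.
have [k] := ubnP (size v); elim: k v => // k IHk v ltvk lt_uv Uv.
have [->|v_neq0] := eqVneq v [::]; first by rewrite stack_sort_nil !cats0.
have [L [N [R [def_v ltN]]]] := split_max v_neq0 Uv.
rewrite def_v catA stack_sortE; last first.
  move=> x; rewrite -catA mem_cat => /orP[ux|/ltN//].
  by apply: lt_uv; rewrite // def_v mem_cat mem_head orbT.
rewrite stack_sortE // IHk ?catA //.
- by move: ltvk; rewrite def_v size_cat /=; lia.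
- by move=> x y ux Ly; rewrite lt_uv // def_v mem_cat Ly.
- by move: Uv; rewrite def_v cat_uniq => /andP[].
Qed.

Lemma avoids321_leq m m' w : m' <= m -> avoids321 m w -> avoids321 m' w.
Proof.
elim: w m m' => //= x w IHw m m' le_m /andP[/implyP xw avw].
rewrite (IHw (maxn m x)) ?geq_max ?leq_max ?le_m ?leqnn ?orbT // andbT.
by apply/implyP => /leq_trans/(_ le_m).
Qed.

Lemma avoids321_cat m m' u v :
    m' <= m -> {in u, forall x, x <= m} -> {in v, forall y, m <= y} ->
  avoids321 m' u -> avoids321 m v -> avoids321 m' (u ++ v).
Proof.
move=> le_m leu lev avu avv; elim: u m' le_m leu avu => [|x u IHu] m' le_m leu /=.
  by move=> _; apply: avoids321_leq avv.
case/andP=> /implyP xu avu; have le_xm : x <= m by rewrite leu ?mem_head.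
rewrite IHu ?geq_max ?le_m // ?andbT; last first.
  by move=> y uy; rewrite leu // inE uy orbT.
apply/implyP => /xu xu'; rewrite all_cat xu'; apply/allP => y /lev.
exact: leq_trans.
Qed.

Lemma avoids321_map_addn d m w :
  avoids321 (d + m) (map (addn d) w) = avoids321 m w.
Proof.
elim: w m => //= x w IHw m; rewrite -addn_maxr IHw ltn_add2l all_map.
by congr ((_ ==> _) && _); apply: eq_all => y /=; rewrite leq_add2l.
Qed.

Lemma stack_sort_map_addn d w :
  uniq w -> stack_sort (map (addn d) w) = map (addn d) (stack_sort w).
Proof.
have [k] := ubnP (size w); elim: k w => // k IHk w ltwk Uw.
have [->//|w_neq0] := eqVneq w [::].
have [L [N [R [def_w ltN]]]] := split_max w_neq0 Uw.
move: ltwk Uw; rewrite def_w size_cat cat_uniq /= => ltwk /and4P[UL _ _ UR].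
rewrite map_cat map_cons (stack_sortE ltN) stack_sortE; last first.
  by rewrite -map_cat => _ /mapP[x /ltN ltxN ->]; rewrite ltn_add2l.
rewrite !map_cat !IHk //; move: ltwk; rewrite addnS ltnS;
  by apply: leq_ltn_trans; rewrite ?leq_addr ?leq_addl.
Qed.

Lemma preim321_cat m n u v :
  u \in preim321 m -> v \in preim321 n ->
  u ++ map (addn m) v \in preim321 (m + n).
Proof.
rewrite !mem_preim321 => /andP[pu avu] /andP[pv avv].
have iotaD : iota 1 (m + n) = iota 1 m ++ map (addn m) (iota 1 n).
  by rewrite iotaD -iotaDl addnC.
have perm_uv : perm_eq (u ++ map (addn m) v) (iota 1 (m + n)).
  by rewrite iotaD perm_cat // perm_map.
have Uv : uniq v by rewrite (perm_uniq pv) iota_uniq.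
rewrite perm_uv /= stack_sort_cat ?map_inj_uniq //; last 2 first.
- move=> x _ /[swap] /mapP[y yv ->].
  rewrite (perm_mem pu) mem_iota => /andP[_].
  by move: yv; rewrite (perm_mem pv) mem_iota; lia.
- exact: addnI.
rewrite stack_sort_map_addn //; apply: (@avoids321_cat m) => //.
- by move=> x; rewrite (perm_mem (perm_stack_sort u)) (perm_mem pu) mem_iota; lia.
- by move=> _ /mapP[y _ ->]; apply: leq_addr.
- by rewrite -[X in avoids321 X]addn0 avoids321_map_addn.
Qed.

Lemma preim321_supermul m n :
  size (preim321 m) * size (preim321 n) <= size (preim321 (m + n)).
Proof.
pose f (u v : seq nat) := u ++ map (addn m) v.
have szu u : u \in preim321 m -> size u = m.
  by rewrite mem_preim321 => /andP[/perm_size-> _]; rewrite size_iota.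
rewrite -(size_allpairs f).
apply: uniq_leq_size.
  apply: allpairs_uniq; try exact: stack_sort_preim_uniq.
  move=> [u v] [u' v'] /allpairsP[[a b] [/= /szu sza _ [-> ->]]].
  case/allpairsP=> [[a' b'] [/= /szu sza' _ [-> ->]]] /eqP.
  rewrite /f eqseq_cat ?sza ?sza' // => /andP[/eqP-> /eqP].
  by move/(inj_map (@addnI m)) ->.
by move=> _ /allpairsP[[u v] [/= um vn ->]]; apply: preim321_cat.
Qed.

Lemma preim321_gt0 n : 0 < size (preim321 n).
Proof.
have gt0 k w : w \in preim321 k -> 0 < size (preim321 k).
  by case: (preim321 k).
elim: n => [|n IHn]; first by apply: (gt0 0 [::]); rewrite mem_preim321.
rewrite -(addn1 n); apply: leq_trans (preim321_supermul n 1).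
by rewrite muln_gt0 IHn (gt0 1 [:: 1]) // mem_preim321.
Qed.

(** * Encoding a preimage by jumps and node types *)

(* [w] is the in-order word of a decreasing binary tree whose postorder word is
   [stack_sort w]; [postorder w] also records, with each label, whether the node
   has a left and a right child. *)
Fixpoint postorder_rec (k : nat) (w : seq nat) : seq (nat * (bool * bool)) :=
  match k, w with
  | k'.+1, _ :: _ =>
      let N := max_entry w in
      let i := index N w in
      postorder_rec k' (take i w) ++ postorder_rec k' (drop i.+1 w) ++
        [:: (N, (take i w != [::], drop i.+1 w != [::]))]
  | _, _ => [::]
  end.

Definition postorder (w : seq nat) := postorder_rec (size w) w.

Lemma postorder_recE k (L R : seq nat) N :
    {in L ++ R, forall x, x < N} ->
  postorder_rec k.+1 (L ++ N :: R) = postorder_rec k L ++ postorder_rec k R ++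
    [:: (N, (L != [::], R != [::]))].
Proof.
move=> ltN; set w := L ++ N :: R.
have w_neq0 : w != [::] by rewrite /w; case: (L).
have maxw : max_entry w = N.
  apply/eqP; rewrite eqn_leq max_entry_ge ?mem_cat ?mem_head ?orbT // andbT.
  have := max_entry_mem w_neq0; move: (max_entry w) => M.
  rewrite mem_cat in_cons orbCA -mem_cat.
  by case/predU1P=> [->|/ltN ltMN]; last exact: ltnW.
have NL : N \notin L.
  by apply/negP=> NL; have := ltN N; rewrite mem_cat NL ltnn => /(_ isT).
have -> : postorder_rec k.+1 w = postorder_rec k (take (index N w) w) ++
    postorder_rec k (drop (index N w).+1 w) ++
    [:: (N, (take (index N w) w != [::], drop (index N w).+1 w != [::]))].
  by rewrite -maxw; clearbody w; case: w w_neq0 {maxw}.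
have -> : index N w = size L by rewrite index_cat (negPf NL) /= eqxx addn0.
have -> : drop (size L).+1 w = R.
  by rewrite /w -cat_rcons drop_size_cat ?size_rcons.
by rewrite take_size_cat.
Qed.

Lemma postorder_rec_stable k (w : seq nat) :
  uniq w -> size w <= k -> postorder_rec k w = postorder w.
Proof.
suff stable k1 k2 (v : seq nat) : uniq v -> size v <= k1 -> size v <= k2 ->
    postorder_rec k1 v = postorder_rec k2 v.
  by move=> Uw lewk; apply: stable.
elim: k1 k2 v => [|k1 IHk] [|k2] v; try by case: v.
move=> Uv; have [->//|v_neq0] := eqVneq v [::].
have [L [N [R [def_v ltN]]]] := split_max v_neq0 Uv.
move: Uv; rewrite def_v !postorder_recE // size_cat cat_uniq /=.
move=> /and4P[UL _ _ UR] le1 le2.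
by congr (_ ++ (_ ++ _)); apply: IHk => //; lia.
Qed.

Lemma postorderE (L R : seq nat) N :
    uniq (L ++ N :: R) -> {in L ++ R, forall x, x < N} ->
  postorder (L ++ N :: R) =
    postorder L ++ postorder R ++ [:: (N, (L != [::], R != [::]))].
Proof.
move=> U ltN; rewrite -(postorder_rec_stable U (leqnSn _)) postorder_recE //.
move: U; rewrite cat_uniq /= => /and4P[UL _ _ UR].
by rewrite !postorder_rec_stable // size_cat /=; lia.
Qed.

Lemma unzip1_postorder w : unzip1 (postorder w) = stack_sort w.
Proof.
rewrite /postorder /stack_sort /unzip1; move: (size w) => k.
elim: k w => //= k IHk [|a v] //.
by rewrite !map_cat !IHk.
Qed.

(** Induction on decreasing binary trees, represented by their in-order words: the root is the
    largest entry. *)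
Lemma tree_ind (P : seq nat -> Prop) :
    P [::] ->
    (forall L N R, uniq (L ++ N :: R) -> {in L ++ R, forall x, x < N} ->
       P L -> P R -> P (L ++ N :: R)) ->
  forall w : seq nat, uniq w -> P w.
Proof.
move=> P0 Pnode w; have [k] := ubnP (size w); elim: k w => // k IHk w ltwk Uw.
have [->//|w_neq0] := eqVneq w [::].
have [L [N [R [def_w ltN]]]] := split_max w_neq0 Uw.
move: ltwk (Uw); rewrite def_w size_cat cat_uniq /= => ltwk /and4P[UL _ _ UR].
by apply: Pnode; rewrite -?def_w //; apply: IHk => //; lia.
Qed.

(** [st] holds the in-order words of the pending subtrees, latest first; in postorder a right
    subtree follows the left one, so it is popped first. *)
Definition attach (st : seq (seq nat)) (x : nat) (t : bool * bool) :=
  let R := if t.2 then head [::] st else [::] in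
  let st1 := if t.2 then behead st else st in
  let L := if t.1 then head [::] st1 else [::] in
  let st2 := if t.1 then behead st1 else st1 in
  (L ++ x :: R) :: st2.

Fixpoint build (st : seq (seq nat)) (w : seq (nat * (bool * bool))) :=
  if w is (x, t) :: w' then build (attach st x t) w' else st.

Lemma build_postorder w : uniq w -> forall st e,
  build st (postorder w ++ e) = build (if w == [::] then st else w :: st) e.
Proof.
move: w; apply: tree_ind => // L N R U ltN IHL IHR st e.
rewrite postorderE // -!catA IHL IHR /= /attach.
by case: L R {U ltN IHL IHR} => [|a L] [|b R] /=; rewrite ?eqseqE ?cats0.
Qed.

Lemma postorder_inj : {in uniq &, injective postorder}.
Proof.
suff K w : uniq w -> head [::] (build [::] (postorder w)) = w.
  by move=> u v Uu Uv eq_uv; rewrite -(K u Uu) eq_uv K.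
move=> Uw; have := build_postorder Uw [::] [::]; rewrite cats0 => -> /=.
by case: eqP => [->|].
Qed.

(* Truncated subtraction: an entry below the running maximum [m] has jump 0. *)
Fixpoint jumps (m : nat) (w : seq (nat * (bool * bool))) :=
  if w is (x, t) :: w' then (x - m, t) :: jumps (maxn m x) w' else [::].

(* In a 321-avoiding word, an entry that is not a record is the least unused
   value below the running maximum; [q] lists these values. *)
Fixpoint unjump (m : nat) (q : seq nat) (w : seq (nat * (bool * bool))) :=
  if w is (j, t) :: w' then
    if j is 0 then (head 0 q, t) :: unjump m (behead q) w'
    else (m + j, t) :: unjump (m + j) (q ++ iota m.+1 j.-1) w'
  else [::].

Lemma sorted_ltn_cat_iota m q j :
  sorted ltn q -> {in q, forall y, y <= m} -> sorted ltn (q ++ iota m.+1 j).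
Proof.
rewrite !(sorted_pairwise ltn_trans) pairwise_cat => -> ltqm /=.
rewrite -(sorted_pairwise ltn_trans) iota_ltn_sorted andbT.
by apply/allrelP => y z /ltqm ltym; rewrite mem_iota => /andP[lt_mz _]; lia.
Qed.

Lemma jumpsK m q J w :
    perm_eq (unzip1 w) (q ++ iota m.+1 J) -> sorted ltn q ->
    {in q, forall y, y < m} -> avoids321 m (unzip1 w) ->
  unjump m q (jumps m w) = w.
Proof.
elim: w m q J => //= -[x t] w IHw m q J /= perm_w sq ltqm /andP[/implyP xw avw].
have xqJ : x \in q ++ iota m.+1 J by rewrite -(perm_mem perm_w) mem_head.
have [le_xm|lt_mx] := leqP x m; last first.
  have [j def_x] : exists j, x = m + j.+1 by exists (x - m).-1; lia.
  have lejJ : j < J.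
    move: xqJ; rewrite mem_cat mem_iota => /orP[/ltqm|]; lia.
  have -> : x - m = j.+1 by lia.
  rewrite -def_x /=; congr (_ :: _).
  rewrite (maxn_idPr (ltnW lt_mx)) in avw *.
  apply: (IHw _ _ (J - j.+1) _ _ _ avw).
  - move: perm_w; have -> : J = j + (J - j.+1).+1 by lia.
    rewrite iotaD /= addSn -addnS -def_x catA.
    rewrite perm_sym -cat1s perm_catCA perm_cons perm_sym.
    by have -> : j + (J - j.+1).+1 - j.+1 = J - j.+1 by lia.
  - by apply: sorted_ltn_cat_iota => // y /ltqm/ltnW.
  - move=> y; rewrite mem_cat mem_iota => /orP[/ltqm|]; lia.
have /eqP-> : x - m == 0 by rewrite subn_eq0.
have xq : x \in q.
  by move: xqJ; rewrite mem_cat mem_iota => /orP[//|]; lia.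
case: q xq sq ltqm perm_w {xqJ} => // y q xq /= sq ltqm perm_w.
have yw : y \in x :: unzip1 w by rewrite (perm_mem perm_w) mem_head.
have def_y : y = x.
  have le_yx : y <= x.
    move: xq; rewrite inE => /predU1P[->//|xq].
    exact/ltnW/(allP (order_path_min ltn_trans sq)).
  move: yw; rewrite inE => /predU1P[//|yw].
  by apply/eqP; rewrite eqn_leq le_yx (allP (xw (ltqm x xq)) y yw).
rewrite def_y (maxn_idPl le_xm) in avw *; congr (_ :: _).
apply: (IHw _ _ J _ _ _ avw).
- by move: perm_w; rewrite def_y /= perm_cons.
- by move/path_sorted: sq.
- by move=> z zq; apply: ltqm; rewrite inE zq orbT.
Qed.

(** * Words accepted by an automaton *)

Notation letter := (nat * (bool * bool))%type.

Definition arity (t : bool * bool) : nat := t.1 + t.2.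

Definition node_types : seq (bool * bool) :=
  [:: (false, false); (true, false); (false, true); (true, true)].

Definition letters (J : nat) : seq letter :=
  [seq (j, t) | j <- iota 0 J, t <- node_types].

Lemma letters_uniq J : uniq (letters J).
Proof. by apply: allpairs_uniq => [||[a b] [c d] _ _ //]; rewrite ?iota_uniq. Qed.

Lemma mem_letters J a : (a \in letters J) = (a.1 < J).
Proof.
case: a => j t; apply/allpairsP/idP => [[[i u] [/= iJ _ [-> _]]]|ltjJ].
  by move: iJ; rewrite mem_iota.
by exists (j, t); split; rewrite ?mem_iota //; case: t {ltjJ} => -[] [].
Qed.

Fixpoint words (A : seq letter) (n : nat) : seq (seq letter) :=
  if n is n'.+1 then [seq a :: w | a <- A, w <- words A n'] else [:: [::]].

Lemma words_uniq A n : uniq A -> uniq (words A n).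
Proof.
move=> UA; elim: n => //= n IHn.
by apply: allpairs_uniq => // -[a v] [b w] _ _ [-> ->].
Qed.

Lemma mem_words A n w : (w \in words A n) = (size w == n) && all (mem A) w.
Proof.
elim: n w => [|n IHn] [|a w] //=; first by apply/allpairsP => -[[b v] [_ _]].
rewrite eqSS andbCA -IHn; apply/allpairsP/andP => [[[b v] [/= ? ? [-> ->]]]|[]] //.
by move=> aA wA; exists (a, w).
Qed.

Section Automaton.

Variables (S : Type) (step : S -> letter -> option S) (final : pred S).

Fixpoint accepts (s : S) (w : seq letter) : bool :=
  if w is a :: w' then oapp (accepts^~ w') false (step s a) else final s.

Definition count_accepted A n s := count (accepts s) (words A n).

Lemma count_acceptedS A n s :
  count_accepted A n.+1 s = \sum_(a <- A) oapp (count_accepted A n) 0 (step s a).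
Proof.
rewrite /count_accepted /= count_flatten -map_comp sumnE big_map.
apply: eq_bigr => a _ /=; rewrite count_map.
case Es: (step s a) => [s'|] /=; last first.
  by rewrite (@eq_count _ _ pred0) ?count_pred0 // => w /=; rewrite Es.
by apply: eq_count => w /=; rewrite Es.
Qed.

End Automaton.

(** * The upper bound *)

(* State: remaining jumps, number of pending subtrees, and whether the last
   entry was a record. An entry following a smaller child cannot be below its
   predecessor, so a non-record right after a record is a leaf. *)
Definition up_step (s : nat * nat * bool) (a : letter) :=
  let: (J, k, f) := s in let: (j, t) := a in
  if [&& arity t <= k, j <= J & [|| 0 < j, ~~ f | t == (false, false)]]
  then Some (J - j, (k - arity t).+1, 0 < j) else None.

Definition up_final (s : nat * nat * bool) := (s.1.1 == 0) && (s.1.2 == 1).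

Fixpoint stack_ok (k : nat) (ts : seq (bool * bool)) : bool :=
  if ts is t :: ts' then (arity t <= k) && stack_ok (k - arity t).+1 ts'
  else k == 1.

(** [p] is the preceding entry: in postorder a node with a child directly follows an entry of one of
    its subtrees. *)
Fixpoint child_lt (p : nat) (e : seq letter) : bool :=
  if e is (x, t) :: e' then ((t != (false, false)) ==> (p < x)) && child_lt x e'
  else true.

Lemma child_lt_cat p e1 e2 :
  child_lt p (e1 ++ e2) = child_lt p e1 && child_lt (last p (unzip1 e1)) e2.
Proof. by elim: e1 p => //= -[x t] e1 IHe p; rewrite IHe andbA. Qed.

Lemma child_lt_postorder w : uniq w -> forall p, child_lt p (postorder w).
Proof.
move: w; apply: tree_ind => // L N R U ltN IHL IHR p.
rewrite postorderE // !child_lt_cat IHL IHR /= andbT; apply/implyP => LR.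
rewrite !unzip1_postorder -last_cat; apply: ltN.
rewrite -(perm_mem (perm_cat (perm_stack_sort L) (perm_stack_sort R))).
have: stack_sort L ++ stack_sort R != [::].
  rewrite -size_eq0 size_cat !(perm_size (perm_stack_sort _)).
  by case: L R LR {U IHL IHR} => [|? ?] [].
by case: (_ ++ _) => //= x v _; apply: mem_last.
Qed.

Lemma stack_ok_postorder w : uniq w -> forall k ts,
  stack_ok k (unzip2 (postorder w) ++ ts) = stack_ok (k + (w != [::])) ts.
Proof.
move: w; apply: tree_ind => [|L N R U ltN IHL IHR] k ts /=; first by rewrite addn0.
rewrite postorderE // /unzip2 !map_cat -!catA IHL IHR /= /arity -addnA leq_addl.
by rewrite addnK; case: (L) => *; rewrite -[RHS]/(stack_ok (k + 1) ts) addn1.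
Qed.

(** [m + J] is the final maximum, so [J] is the sum of the jumps to come. After a record [p = m], so
    a node with a child exceeds [m] and is again a record. *)
Lemma accepts_jumps m p J k f e :
    all (fun x => x <= m + J) (unzip1 e) -> m + J \in m :: unzip1 e ->
    stack_ok k (unzip2 e) -> child_lt p e -> (f ==> (p == m)) ->
  accepts up_step up_final (J, k, f) (jumps m e).
Proof.
elim: e m p J k f => [|[x t] e IHe] m p J k f /=.
  by rewrite /up_final inE -[X in _ == X]addn0 eqn_add2l /= => _ -> ->.
case/andP=> lex leE inE1 /andP[ak sok] /andP[/implyP pt clt] /implyP fp.
have lexJ : x - m <= J by lia.
rewrite ak lexJ /=.
have -> : [|| 0 < x - m, ~~ f | t == (false, false)].
  rewrite subn_gt0; case: (ltnP m x) => //= le_xm.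
  case: f fp => //= /(_ isT) /eqP pm; apply: contraTT le_xm => /pt; lia.
have eJ : maxn m x + (J - (x - m)) = m + J by lia.
apply: (IHe _ x) => //=; rewrite ?eJ //.
- move: inE1; rewrite !inE => /or3P[/eqP eqm | /eqP eqx | ->]; rewrite ?orbT //.
    by apply/orP; left; apply/eqP; lia.
  by apply/orP; left; apply/eqP; lia.
- by apply/implyP; rewrite subn_gt0 => ltmx; apply/eqP; lia.
Qed.

Lemma code_accepted n w : 0 < n -> w \in preim321 n ->
  accepts up_step up_final (n, 0, true) (jumps 0 (postorder w)).
Proof.
move=> n_gt0; rewrite mem_preim321 => /andP[pw _].
have Uw : uniq w by rewrite (perm_uniq pw) iota_uniq.
have memw : unzip1 (postorder w) =i iota 1 n.
  by move=> x; rewrite unzip1_postorder (perm_mem (perm_stack_sort w)) (perm_mem pw).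
apply: (@accepts_jumps 0 0) => //.
- by apply/allP => x; rewrite memw mem_iota; lia.
- by rewrite inE memw mem_iota; lia.
- rewrite -[unzip2 _]cats0 stack_ok_postorder //=.
  by case: w pw {Uw memw} => //; case: n n_gt0 => // n _ /perm_size.
- exact: child_lt_postorder.
Qed.

Lemma jumps_postorder_inj n :
  {in preim321 n &, injective (fun w => jumps 0 (postorder w))}.
Proof.
have K w : w \in preim321 n ->
    uniq w /\ unjump 0 [::] (jumps 0 (postorder w)) = postorder w.
  rewrite mem_preim321 => /andP[pw avw].
  split; first by rewrite (perm_uniq pw) iota_uniq.
  apply: (@jumpsK _ _ n) => //; rewrite unzip1_postorder //.
  exact: perm_trans (perm_stack_sort w) pw.
move=> u v /K[Uu Ku] /K[Uv Kv] eq_uv; apply: postorder_inj => //.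
by rewrite -Ku eq_uv Kv.
Qed.

Lemma size_jumps m e : size (jumps m e) = size e.
Proof. by elim: e m => //= -[x t] e IHe m /=; rewrite IHe. Qed.

Lemma size_postorder w : size (postorder w) = size w.
Proof.
rewrite -(size_map fst) -[map _ _]/(unzip1 _) unzip1_postorder.
exact/perm_size/perm_stack_sort.
Qed.

Lemma accepted_letters J k f w :
  accepts up_step up_final (J, k, f) w -> all (fun a => a.1 <= J) w.
Proof.
elim: w J k f => //= -[j t] w IHw J k f /=; case: ifP => //= /and3P[_ lejJ _].
move=> /IHw le_w; rewrite lejJ; apply: sub_all le_w => a; lia.
Qed.

Lemma preim321_le_count n : 0 < n ->
  size (preim321 n) <=
    count_accepted up_step up_final (letters n.+1) n (n, 0, true).
Proof.
move=> n_gt0; rewrite /count_accepted -size_filter.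
rewrite -(size_map (fun w => jumps 0 (postorder w))).
apply: uniq_leq_size.
  by rewrite map_inj_in_uniq ?stack_sort_preim_uniq //; apply: jumps_postorder_inj.
move=> _ /mapP[w wn ->]; have acc := code_accepted n_gt0 wn.
rewrite mem_filter acc mem_words size_jumps size_postorder.
have: size w = n.
  by move: wn; rewrite mem_preim321 => /andP[/perm_size-> _]; rewrite size_iota.
move->; rewrite eqxx /=; apply: sub_all (accepted_letters acc) => a /=.
by rewrite mem_letters ltnS.
Qed.

(** The weight [b] is a supersolution of the transfer recursion: one more letter multiplies the
    bound by [mu]. *)
Lemma count_accepted_le (R : realFieldType) (S : Type)
    (step : S -> letter -> option S) (final : pred S) (A : seq letter)
    (b : S -> R) (mu : R) :
    (forall s, final s -> (1 <= b s)%R) -> (forall s, (0 <= b s)%R) ->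
    (forall s, (\sum_(a <- A) oapp b 0 (step s a) <= mu * b s)%R) ->
    (0 <= mu)%R ->
  forall n s, ((count_accepted step final A n s)%:R <= mu ^+ n * b s)%R.
Proof.
move=> b1 b0 b_step mu0; elim=> [|n IHn] s.
  rewrite expr0 mul1r /count_accepted /= addn0.
  by case: (boolP (final s)) => [/b1|_] //=.
rewrite count_acceptedS natr_sum exprSr -mulrA.
apply: le_trans (ler_wpM2l (exprn_ge0 n mu0) (b_step s)).
rewrite mulr_sumr; apply: ler_sum => a _.
by case: (step s a) => [s'|] /=; rewrite ?mulr0.
Qed.

(** A geometric series with its remainder: a record of jump [j] costs a factor 2^(-j), and these
    factors sum to at most 1. *)
Lemma sum_jump_weights J A :
  \sum_(0 <= j < A.+1) (if (0 < j) && (j <= J) then 2 ^ (J - j) else 0)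
    + 2 ^ (J - A) = 2 ^ J.
Proof.
elim: A => [|A IHA]; first by rewrite big_nat1 subn0.
rewrite big_nat_recr //= -IHA -addnA; congr (_ + _).
case: leqP => [leJA|ltAJ]; first by rewrite /= add0n; congr (2 ^ _); lia.
have -> : J - A = (J - A.+1).+1 by lia.
by rewrite expnS mul2n addnn.
Qed.

(** * An eigenvector of the transfer matrix *)

Section UpperWeights.

Variable R : realFieldType.
Local Open Scope ring_scope.

(* The weights u = 12/17 of a leaf, 1 of a unary node and 1/u of a binary node
   make the total weight of a word independent of its number of leaves, and
   12/17 approximates the optimal 1/sqrt 2. *)
Definition up_weight (s : nat * nat * bool) : R :=
  2 ^+ s.1.1 * (12 / 17) ^+ s.1.2 * (if s.2 then 1 else 29 / 12).

Lemma up_weight_ge0 s : 0 <= up_weight s.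
Proof. by rewrite /up_weight !mulr_ge0 ?exprn_ge0 ?divr_ge0 //; case: ifP. Qed.

(** The four node types weigh 12/17 + 1 + 1 + 17/12 = 841/204. A non-record brings the factor 29/12;
    after a record it must be a leaf, hence 12/17 * 29/12 = 29/17. *)
Lemma up_weight_node_types J k f j :
  \sum_(t <- node_types) oapp up_weight 0 (up_step (J, k, f) (j, t)) <=
    (12 / 17) ^+ k * (if (0 < j)%N && (j <= J)%N then 2 ^+ (J - j) * (841 / 204)
      else if j == 0%N
        then 2 ^+ J * (if f then 29 / 17 else 841 / 204 * (29 / 12)) else 0).
Proof.
have a_ge0 : 0 <= (12 / 17 : R) ^+ k by rewrite exprn_ge0 ?divr_ge0.
have p_ge0 i : 0 <= 2 ^+ i * (12 / 17 : R) ^+ k by rewrite mulr_ge0 ?exprn_ge0.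
rewrite !big_cons big_nil /up_step /arity /=.
case: j => [|j] /=; last case: (j < J)%N.
- have := p_ge0 J; rewrite subn0 /up_weight.
  by case: f k a_ge0 {p_ge0} => -[|[|k]] a_ge0 /=;
    rewrite ?subn0 ?subn1 ?subn2 ?exprS ?expr0 /=; lra.
- have := p_ge0 (J - j.+1)%N; rewrite /up_weight.
  by case: k a_ge0 {p_ge0} => [|[|k]] a_ge0 /=;
    rewrite ?subn0 ?subn1 ?subn2 ?exprS ?expr0 /=; lra.
- by rewrite !andbF /= !addr0 mulr0.
Qed.

(** Once the jumps are summed, (1, 29/12) is an eigenvector for 1189/204: 841/204 + 29/17 = 1189/204
    and 841/204 * (1 + 29/12) = 1189/204 * 29/12. *)
Lemma up_weight_step A s :
  \sum_(a <- letters A.+1) oapp up_weight 0 (up_step s a) <= 1189 / 204 * up_weight s.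
Proof.
case: s => [[J k] f]; rewrite /letters big_allpairs_dep /=.
pose h j : R := (if (0 < j)%N && (j <= J)%N then 2 ^ (J - j) else 0)%N%:R.
pose z j : R := if j == 0%N
  then 2 ^+ J * (if f then 29 / 17 else 841 / 204 * (29 / 12)) else 0.
apply: (@le_trans _ _ (\sum_(j <- iota 0 A.+1)
    (12 / 17) ^+ k * (h j * (841 / 204) + z j))).
  apply: ler_sum => j _; apply: le_trans (up_weight_node_types J k f j) _.
  rewrite ler_wpM2l ?exprn_ge0 ?divr_ge0 // /h /z.
  by case: ifP => [/andP[j_gt0 _]|_]; rewrite ?natrX ?mul0r ?add0r // gtn_eqF // addr0.
rewrite -mulr_sumr big_split /= -mulr_suml.
have -> : \sum_(j <- iota 0 A.+1) z j = z 0%N.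
  rewrite /= big_cons big1_seq ?addr0 // => j /andP[_].
  by rewrite mem_iota /z => /andP[/gtn_eqF->].
have hJ : \sum_(j <- iota 0 A.+1) h j <= 2 ^+ J.
  by rewrite -natr_sum -natrX ler_nat -(sum_jump_weights J A) leq_addr.
rewrite /up_weight /z /=.
have a_ge0 : 0 <= (12 / 17 : R) ^+ k by rewrite exprn_ge0 ?divr_ge0.
move: hJ; move: (\sum_(j <- _) _) => H hJ.
have: 0 <= (12 / 17) ^+ k * (2 ^+ J - H) by rewrite mulr_ge0 ?subr_ge0.
by move: (2 ^+ J) ((12 / 17) ^+ k) => P a {hJ a_ge0}; case: f {z}; lra.
Qed.

(** The initial weight 2^n doubles the rate 1189/204, and a final state weighs at least 12/17,
    whence the factor 17/12. *)
Lemma preim321_upper n :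
  (0 < n)%N -> (size (preim321 n))%:R <= 17 / 12 * (1189 / 102 : R) ^+ n.
Proof.
move=> n_gt0.
have final s : up_final s -> 1 <= 17 / 12 * up_weight s.
  case: s => -[J k] f /andP[/= /eqP-> /eqP->].
  by rewrite /up_weight /= expr0 expr1; case: f; lra.
have weight_ge0 s : 0 <= 17 / 12 * up_weight s.
  by rewrite mulr_ge0 ?up_weight_ge0 ?divr_ge0.
have step s : \sum_(a <- letters n.+1)
    oapp (fun s' => 17 / 12 * up_weight s') 0 (up_step s a) <=
    1189 / 204 * (17 / 12 * up_weight s).
  rewrite mulrCA; apply: le_trans (ler_wpM2l _ (up_weight_step n s)); last first.
    by rewrite divr_ge0.
  rewrite mulr_sumr; apply: ler_sum => a _.
  by case: (up_step s a) => [s'|] /=; rewrite ?mulr0.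
have mu_ge0 : 0 <= 1189 / 204 :> R by apply: divr_ge0; apply: ler0n.
have := count_accepted_le final weight_ge0 step mu_ge0 n (n, 0%N, true).
have := preim321_le_count n_gt0; rewrite -(ler_nat R).
move: (count_accepted _ _ _ _ _)%:R (_%:R) => c p le_pc /(le_trans le_pc).
congr (_ <= _); rewrite /up_weight /= expr0 !mulr1 mulrCA -exprMn.
by congr (_ * _ ^+ _); field.
Qed.

End UpperWeights.

(** * The lower bound *)

(* State: number of unused values below the running maximum, number of pending
   subtrees, and whether the last entry was a record. A non-record is a leaf, or
   a unary node over a non-record: both are larger than their descendants. *)
Definition low_step (s : nat * nat * bool) (a : letter) :=
  let: (h, k, f) := s in let: (j, t) := a in
  if (arity t <= k) && ((0 < j) || (0 < h) && (arity t <= ~~ f))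
  then Some ((h + j).-1, (k - arity t).+1, 0 < j) else None.

Definition low_final (s : nat * nat * bool) := (s.1.1 == 0) && (s.1.2 == 1).

(** Each later entry is in [q] or above [m]; a non-record takes the least element of [q], so nothing
    smaller follows it. *)
Lemma unjump_avoids321 m q k f w :
    accepts low_step low_final (size q, k, f) w ->
    sorted ltn q -> {in q, forall y, y < m} ->
  [/\ {in unzip1 (unjump m q w), forall y, (y \in q) || (m < y)},
      avoids321 m (unzip1 (unjump m q w)) & jumps m (unjump m q w) = w].
Proof.
elim: w m q k f => //= -[[|j] t] w IHw m q k f /=.
  case: q => [|x q]; rewrite ?andbF //=; case: ifP => //= _; rewrite addn0.
  move=> acc sq ltqm; have lexm : x < m by rewrite ltqm ?mem_head.
  have := IHw m q _ _ acc (path_sorted sq); case=> [y yq|memu avu def_w].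
    by rewrite ltqm // inE yq orbT.
  have /eqP-> : x - m == 0 by rewrite subn_eq0 ltnW.
  rewrite (maxn_idPl (ltnW lexm)) def_w avu lexm andbT; split=> //.
    move=> y; rewrite !inE => /predU1P[->|/memu]; rewrite ?eqxx -?orbA //.
    by move->; rewrite orbT.
  apply/allP => y /memu /orP[yq|]; last by lia.
  exact/ltnW/(allP (order_path_min ltn_trans sq)).
case: ifP => //= _ acc sq ltqm.
have szq : size (q ++ iota m.+1 j) = (size q + j.+1).-1.
  by rewrite size_cat size_iota addnS.
rewrite -szq in acc.
case: (IHw (m + j.+1) _ _ _ acc (sorted_ltn_cat_iota j sq _)).
  by move=> y /ltqm/ltnW.
  by move=> y; rewrite mem_cat mem_iota => /orP[/ltqm|]; lia.
move=> memu avu def_w.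
have -> : m + j.+1 - m = j.+1 by lia.
have -> : maxn m (m + j.+1) = m + j.+1 by lia.
rewrite def_w avu ltnNge leq_addr; split=> // y.
rewrite inE => /predU1P[->|/memu]; first by rewrite addnS ltnS leq_addr orbT.
rewrite mem_cat mem_iota => /orP[/orP[->//|/andP[-> _]]|]; first exact: orbT.
by move/(leq_ltn_trans (leq_addr _ _)) ->; rewrite orbT.
Qed.

(** * Trees built from accepted words *)

Fixpoint forest (st : seq (seq nat)) : seq letter :=
  if st is w :: st' then forest st' ++ postorder w else [::].

Lemma size_attach st x t :
  arity t <= size st -> size (attach st x t) = (size st - arity t).+1.
Proof. by case: t => -[] []; case: st => [|u [|v st]]; rewrite /arity /=; lia. Qed.

Lemma perm_attach st x t : arity t <= size st ->
  perm_eq (flatten (attach st x t)) (x :: flatten st).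
Proof.
case: t => -[] []; case: st => [|u [|v st]] // _;
  rewrite /attach /= ?cats0; apply/permP => p; rewrite /= ?count_cat /= ?count_cat; lia.
Qed.

Lemma mem_head_attach st x t : arity t <= size st ->
  head [::] (attach st x t) =i x :: flatten (take (arity t) st).
Proof.
case: t => -[] []; case: st => [|u [|v st]] // _ y;
  by rewrite /attach /= ?take0 ?cats0 !(inE, mem_cat) ?in_nil ?orbF //;
     do ?bool_congr; rewrite orbC ?orbA.
Qed.

(** The new node is the maximum of the merged word; as no pending subtree is empty, the type
    recorded for it is [t]. *)
Lemma forest_attach st x t :
    arity t <= size st -> uniq (x :: flatten st) -> [::] \notin st ->
    {in flatten (take (arity t) st), forall y, y < x} ->
  forest (attach st x t) = forest st ++ [:: (x, t)].
Proof.
move=> szst Ux nst ltx.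
have U : uniq (head [::] (attach st x t)).
  move: Ux; rewrite -(perm_uniq (perm_attach x szst)) /attach /= cat_uniq.
  by case/andP.
rewrite /attach /= postorderE //.
  move: szst nst {ltx U Ux}; case: t => -[] [] /=.
  - case: st => [|u [|v st]] //= _; rewrite !inE ![[::] == _]eq_sym !negb_or.
    by case/and3P=> -> -> _; rewrite -!catA.
  - case: st => [|u st] //= _; rewrite !inE [[::] == _]eq_sym negb_or.
    by case/andP=> -> _; rewrite -!catA.
  - case: st => [|u st] //= _; rewrite !inE [[::] == _]eq_sym negb_or.
    by case/andP=> -> _; rewrite -!catA.
  - by [].
move=> y yLR; apply: ltx; move: yLR {U Ux nst}.
by case: t szst => -[] []; case: st => [|u [|v st]] //=;
  rewrite ?take0 /= !(mem_cat, in_nil) ?orbF // orbC.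
Qed.

Lemma notin_attach st x t : [::] \notin st -> [::] \notin attach st x t.
Proof.
move=> nst; rewrite inE negb_or; apply/andP; split.
  by rewrite eq_sym; case: (if t.1 then _ else _).
by apply: contra nst; case: t => -[] []; case: st => [|u [|v st]] //=;
  rewrite !inE => ->; rewrite ?orbT.
Qed.

(** Invariant: the pending subtrees and [q] share out the values up to [m], and after a non-record
    the latest subtree lies below all of [q]. So a non-record may be placed over it; a record
    exceeds everything. *)
Lemma build_accepted m q st f w :
    accepts low_step low_final (size q, size st, f) w ->
    sorted ltn q -> perm_eq (flatten st ++ q) (iota 1 m) -> [::] \notin st ->
    (~~ f -> {in head [::] st & q, forall x y, x < y}) ->
  exists v M,
    perm_eq v (iota 1 M) /\ postorder v = forest st ++ unjump m q w.
Proof.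
elim: w m q st f => [|[j t] w IHw] m q st f.
  case: q => // /eqP; case: st => [|v [|v' st]] //= _ _.
  by rewrite !cats0 => pv _ _; exists v, m.
rewrite [accepts _ _ _ _]/=; case: ifP => //= /andP[szst j_ok] acc sq pm nst fst.
have sub_take : {subset flatten (take (arity t) st) <= flatten st}.
  by move=> y yt; rewrite -(cat_take_drop (arity t) st) flatten_cat mem_cat yt.
have Uq : uniq (flatten st ++ q) by rewrite (perm_uniq pm) iota_uniq.
case: j j_ok acc => [/andP[q_gt0 tf]|j _]; last first.
  have -> : (size q + j.+1).-1 = size (q ++ iota m.+1 j).
    by rewrite size_cat size_iota addnS.
  rewrite -(size_attach (m + j.+1) szst) => acc.
  have le_m y : y \in flatten st ++ q -> y <= m.
    by rewrite (perm_mem pm) mem_iota add1n ltnS => /andP[].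
  have ltqm : {in q, forall y, y <= m}.
    by move=> y yq; apply: le_m; rewrite mem_cat yq orbT.
  have le_st y : y \in flatten st -> y <= m.
    by move=> yst; apply: le_m; rewrite mem_cat yst.
  case: (IHw (m + j.+1) _ _ _ acc) => //.
  - exact: sorted_ltn_cat_iota.
  - rewrite (permPl (perm_cat (perm_attach _ szst) (perm_refl _))).
    have -> : iota 1 (m + j.+1) = iota 1 m ++ iota m.+1 j ++ [:: m + j.+1].
      by rewrite iotaD add1n -[in iota m.+1 _](addn1 j) iotaD addSnnS.
    apply/permP => p; have := permP pm p.
    by rewrite !count_cat /= => <-; lia.
  - exact: notin_attach.
  move=> v [M [pv ev]]; exists v, M; split=> //.
  rewrite ev forest_attach -?catA //.
    rewrite /=; apply/andP; split; last by move: Uq; rewrite cat_uniq => /andP[].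
    by apply/negP => /le_st; rewrite addnS ltnNge leq_addr.
  by move=> y /sub_take /le_st; rewrite addnS ltnS => /leq_trans->; rewrite ?leq_addr.
case: q q_gt0 sq pm fst Uq => // x q _ /= sq pm fst Uq.
rewrite addn0 -(size_attach x szst) => acc.
have Ux : uniq (x :: flatten st ++ q) by rewrite -cat1s uniq_catCA.
have ltxq : {in q, forall z, x < z} by exact/allP/(order_path_min ltn_trans sq).
(* After a record the new entry is a leaf, with nothing to compare; otherwise its only possible
   child is the latest subtree. *)
have lt_take : {in flatten (take (arity t) st) & x :: q, forall y z, y < z}.
  move=> y z yt zq; case: f tf fst => /= [|tf fst].
    by rewrite leqn0 => /eqP t0; rewrite t0 take0 in yt.
  apply: fst => //; case: (arity t) tf yt => [|[|k]] // _; first by rewrite take0.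
  by case: (st) => //= u st'; rewrite take0 cats0.
case: (IHw m q _ _ acc (path_sorted sq)).
- rewrite (permPl (perm_cat (perm_attach _ szst) (perm_refl _))).
  by apply: perm_trans pm; rewrite perm_sym -[x :: q]cat1s perm_catCA.
- exact: notin_attach.
- move=> _ y z; rewrite mem_head_attach // inE => /predU1P[->|yt] zq.
    exact: ltxq.
  by apply: lt_take => //; rewrite inE zq orbT.
move=> v [M [pv ev]]; exists v, M; split=> //.
rewrite ev forest_attach -?catA //.
  by move: Ux; rewrite -cat_cons cat_uniq => /andP[].
by move=> y yt; apply: lt_take; rewrite ?mem_head.
Qed.

Lemma accepted_is_code n w :
    size w = n -> accepts low_step low_final (0, 0, true) w ->
  exists2 v, v \in preim321 n & jumps 0 (postorder v) = w.
Proof.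
move=> szw acc.
have [//|_ avu def_w] := @unjump_avoids321 0 [::] 0 true w acc isT.
have [//|v [M [pv /= ev]]] := @build_accepted 0 [::] [::] true w acc isT isT isT.
exists v; rewrite ?ev // mem_preim321 -unzip1_postorder ev avu andbT.
suff <- : M = n by [].
by rewrite -szw -[in RHS]def_w size_jumps -ev size_postorder (perm_size pv) size_iota.
Qed.

Lemma count_le_preim321 A n : uniq A ->
  count_accepted low_step low_final A n (0, 0, true) <= size (preim321 n).
Proof.
move=> UA; rewrite /count_accepted -size_filter.
rewrite -(size_map (fun w => jumps 0 (postorder w)) (preim321 n)).
apply: uniq_leq_size => [|w]; first by rewrite filter_uniq ?words_uniq.
rewrite mem_filter mem_words => /and3P[acc /eqP szw _].
by have [v vn <-] := accepted_is_code szw acc; apply: map_f.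
Qed.

(** [b] is a subsolution with ratio [p / q], and the second hypothesis turns weights into counts at
    the cost of [m] more letters. Denominators are cleared so that concrete weights can be checked
    by computation. *)
Lemma count_accepted_ge (S : Type) (step : S -> letter -> option S)
    (final : pred S) (A : seq letter) (b : S -> nat) (p q K m : nat) :
    (forall s, p * b s <= q * \sum_(a <- A) oapp b 0 (step s a)) ->
    (forall s, b s <= K * count_accepted step final A m s) ->
  forall n s, p ^ n * b s <= q ^ n * (K * count_accepted step final A (n + m) s).
Proof.
move=> b_step bK; elim=> [|n IHn] s; first by rewrite !mul1n.
rewrite expnSr -mulnA; apply: leq_trans (leq_mul (leqnn _) (b_step s)) _.
rewrite addSn count_acceptedS expnSr -mulnA mulnCA [leqRHS]mulnCA.
rewrite leq_mul2l; apply/orP; right; rewrite !big_distrr /= leq_sum // => a _.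
by case: (step s a) => [s'|] /=; rewrite ?muln0.
Qed.

(** * The truncated automaton *)

Lemma count_accepted_gt0 (S : Type) (step : S -> letter -> option S)
    (final : pred S) (A : seq letter) n s w :
  w \in words A n -> accepts step final s w -> 0 < count_accepted step final A n s.
Proof. by move=> wn acc; rewrite -has_count; apply/hasP; exists w. Qed.

(* An approximate Perron vector of the automaton truncated to at most 8 unused
   values and 6 pending subtrees, whose growth rate exceeds 17/2. Row h, column
   k gives the values for f = false and f = true. *)
Definition low_table : seq (seq (nat * nat)) :=
  [:: [:: (0, 254); (795, 795); (1088, 1088); (923, 923);
      (578, 578); (283, 283); (102, 102)];
     [:: (0, 0); (795, 614); (997, 750); (799, 582);
      (470, 334); (215, 148); (69, 45)];
     [:: (0, 0); (559, 379); (655, 428); (493, 305);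
      (272, 161); (115, 65); (33, 17)];
     [:: (0, 0); (332, 205); (367, 216); (257, 141);
      (132, 68); (51, 24); (13, 5)];
     [:: (0, 0); (176, 100); (183, 96); (118, 58);
      (56, 25); (20, 8); (4, 1)];
     [:: (0, 0); (85, 45); (82, 39); (48, 21);
      (21, 8); (6, 2); (1, 0)];
     [:: (0, 0); (38, 18); (33, 14); (17, 6);
      (6, 2); (1, 0); (0, 0)];
     [:: (0, 0); (15, 6); (12, 4); (5, 1);
      (1, 0); (0, 0); (0, 0)];
     [:: (0, 0); (5, 2); (3, 1); (1, 0);
      (0, 0); (0, 0); (0, 0)]].

Definition low_weight (s : nat * nat * bool) : nat :=
  let: (h, k, f) := s in
  let: (x, y) := nth (0, 0) (nth [::] low_table h) k in if f then y else x.

Definition strip : seq (nat * nat * bool) :=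
  [seq (hk, f) | hk <- [seq (h, k) | h <- iota 0 9, k <- iota 0 7],
                 f <- [:: false; true]].

Lemma low_weight_out s : s \notin strip -> low_weight s = 0.
Proof.
case: s => [[h k] f] out; rewrite /low_weight.
suff -> : nth (0, 0) (nth [::] low_table h) k = (0, 0) by case: f {out}.
case: (ltnP h 9) => [lth|leh]; last by rewrite (nth_default [::]) ?nth_nil.
case: (ltnP k 7) => [ltk|lek]; last first.
  apply: nth_default; apply: leq_trans lek.
  by move: h lth {out}; do 9![case=> //].
case/negP: out; apply/allpairsP; exists ((h, k), f).
by rewrite allpairs_f ?mem_iota //; case: f.
Qed.

Lemma low_weight_step s :
  17 * low_weight s <= 2 * \sum_(a <- letters 10) oapp low_weight 0 (low_step s a).
Proof.
case: (boolP (s \in strip)) => [|/low_weight_out->]; last by rewrite muln0.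
(* As [sumn] of a list, the sum can be evaluated by [vm_compute]. *)
rewrite -(big_map (fun a => oapp low_weight 0 (low_step s a)) predT id) -sumnE.
move: s; apply/allP; vm_compute; reflexivity.
Qed.

(* From any state of the strip: empty the queue by leaves, merge the pending
   subtrees by binary nodes, and pad with unary nodes. *)
Definition completion (s : nat * nat * bool) : seq letter :=
  let: (h, k, f) := s in
  let w := if k is 0 then [:: (1, (false, false))]
    else nseq h (0, (false, false)) ++ nseq (h + k).-1 (1, (true, true)) in
  w ++ nseq (21 - size w) (1, (true, false)).

(** 1088 is the largest entry of the table, and 21 the greatest length of a completion before
    padding: 8 leaves and 13 merges. One accepted word per state of positive weight is enough. *)
Lemma low_weight_le_count s :
  low_weight s <= 1088 * count_accepted low_step low_final (letters 10) 21 s.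
Proof.
case: (boolP (s \in strip)) => [|/low_weight_out->//].
case: (posnP (low_weight s)) => [->//|w_gt0 s_strip].
have /and4P[le_w szw lt10 acc] : [&& low_weight s <= 1088,
    size (completion s) == 21, all (fun a => a.1 < 10) (completion s) &
    (0 < low_weight s) ==> accepts low_step low_final s (completion s)].
  move: s s_strip {w_gt0}; apply/allP; vm_compute; reflexivity.
rewrite (leq_trans le_w) // leq_pmulr //.
apply: (@count_accepted_gt0 _ _ _ _ _ _ (completion s)).
  rewrite mem_words szw; apply: sub_all lt10 => a; rewrite /= mem_letters.
  exact: id.
exact: implyP acc w_gt0.
Qed.

(** The initial state has weight 254, and 1088 / 254 < 5. *)
Lemma preim321_lower n : 17 ^ n <= 2 ^ n * (5 * size (preim321 (n + 21))).
Proof.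
have := count_accepted_ge low_weight_step low_weight_le_count n (0, 0, true).
have := count_le_preim321 (n + 21) (letters_uniq 10).
move: (count_accepted _ _ _ _ _) (size _) => c p le_cp.
have -> : low_weight (0, 0, true) = 254 by [].
have := leq_mul (leqnn (2 ^ n)) le_cp; move: (17 ^ n) (2 ^ n) => x y; lia.
Qed.

(** * Existence of the limit *)

Section Limit.

Local Open Scope classical_set_scope.
Local Open Scope ring_scope.

Variable R : realType.

Lemma near_geometric_le (C x y : R) : 0 <= x -> x < y ->
  \forall n \near \oo, C * x ^+ n <= y ^+ n.
Proof.
move=> x_ge0 ltxy; have y_gt0 : 0 < y by apply: le_lt_trans ltxy.
have lt1 : `|x / y| < 1.
  by rewrite ger0_norm ?divr_ge0 ?ltr_pdivrMr ?mul1r // ltW.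
have : (fun n => C * (x / y) ^+ n) @ \oo --> C * 0.
  by apply: cvgMr; apply: cvg_expr.
rewrite mulr0 => /cvgrPdist_lt /(_ 1 ltr01); apply: filterS => n.
rewrite sub0r normrN => /ltW/(le_trans (ler_norm _)).
by rewrite expr_div_n mulrA ler_pdivrMr ?exprn_gt0 ?mul1r.
Qed.

Lemma powR_rootK (x : R) n : (0 < n)%N -> 0 <= x -> (x `^ n%:R^-1) ^+ n = x.
Proof.
move=> n_gt0 x_ge0; rewrite -powR_mulrn ?powR_ge0 // -powRrM mulVf ?powRr1 //.
by rewrite pnatr_eq0 -lt0n.
Qed.

Lemma le_powR_root (x y : R) n :
  (0 < n)%N -> 0 <= x -> 0 <= y -> (x <= y `^ n%:R^-1) = (x ^+ n <= y).
Proof.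
move=> n_gt0 x_ge0 y_ge0.
by rewrite -[in RHS](powR_rootK n_gt0 y_ge0) ler_pXn2r // nnegrE ?powR_ge0.
Qed.

Lemma powR_root_le (x y : R) n :
  (0 < n)%N -> 0 <= x -> 0 <= y -> (y `^ n%:R^-1 <= x) = (y <= x ^+ n).
Proof.
move=> n_gt0 x_ge0 y_ge0.
by rewrite -[in RHS](powR_rootK n_gt0 y_ge0) ler_pXn2r // nnegrE ?powR_ge0.
Qed.

Lemma supermul_exp (a : nat -> nat) m q : (0 < a 0)%N ->
  (forall m n, a m * a n <= a (m + n))%N -> (a m ^ q <= a (q * m))%N.
Proof.
move=> a0 a_mul; elim: q => [|q IHq]; first by rewrite mul0n.
by rewrite expnS mulSn; apply: leq_trans (leq_mul (leqnn _) IHq) (a_mul _ _).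
Qed.

(* Fekete's lemma in multiplicative form. *)
Lemma supermul_cvg_root (a : nat -> nat) (B : R) :
    (forall n, 0 < a n)%N -> (forall m n, a m * a n <= a (m + n))%N ->
    (forall n, (0 < n)%N -> (a n)%:R <= B ^+ n) -> 0 <= B ->
  cvgn (fun n => (a n)%:R `^ n%:R^-1 : R).
Proof.
move=> a_gt0 a_mul aB B_ge0.
pose root n : R := (a n)%:R `^ n%:R^-1.
pose E := [set root n | n in [set n | (0 < n)%N]].
have supE : has_sup E.
  split; first by exists (root 1%N); exists 1%N.
  by exists B => _ [n /= n_gt0 <-]; rewrite powR_root_le // aB.
have root_ge1 n : (0 < n)%N -> 1 <= root n.
  by move=> n_gt0; rewrite le_powR_root // expr1n ler1n.
apply/cvg_ex; exists (sup E); apply/cvgrPdist_le => e e_gt0.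
have [_ [m /= m_gt0 <-]] := sup_adherent e_gt0 supE.
set y := root m => lt_y; have y_ge1 : 1 <= y by apply: root_ge1.
have y_ge0 : 0 <= y by apply: le_trans y_ge1.
have def_am : y ^+ m = (a m)%:R.
  exact: powR_rootK.
(* Write n = q m + r with r < m. Then [a n] is at least [a m ^ q], and as y >= 1 the missing [r]
   factors fit into [y ^+ m]. *)
have low n : y ^+ n <= y ^+ m * (a n)%:R.
  have: (a m ^ (n %/ m) <= a n)%N.
    have := supermul_exp m (n %/ m) (a_gt0 0%N) a_mul.
    move/leq_trans; apply; rewrite {2}(divn_eq n m).
    by apply: leq_trans (a_mul _ _); rewrite leq_pmulr.
  rewrite -(ler_nat R) natrX -def_am -exprM => le_an.
  apply: le_trans (ler_wpM2l (exprn_ge0 m y_ge0) le_an).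
  rewrite -exprD ler_weXn2l // {1}(divn_eq n m) mulnC addnC leq_add2r.
  exact/ltnW/ltn_pmod.
(* The bound is cut off at 0 because comparing [n]-th powers needs a nonnegative base. *)
pose x := Num.max 0 (sup E - e).
have x_ge0 : 0 <= x by rewrite le_max lexx.
have lt_xy : x < y by rewrite gt_max lt_y andbT (lt_le_trans ltr01).
near=> n.
have n_gt0 : (0 < n)%N by near: n; exists 1%N.
have le_sup : root n <= sup E by apply: sup_ubound; [exact: supE.2 | exists n].
rewrite ger0_norm ?subr_ge0 // lerBlDr addrC -lerBlDr.
apply: (@le_trans _ _ x); first by rewrite le_max lexx orbT.
rewrite le_powR_root // -(ler_pM2l (exprn_gt0 m (lt_le_trans ltr01 y_ge1))).
apply: le_trans (low n); near: n; exact: near_geometric_le.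
Unshelve. all: by end_near. Qed.

End Limit.

(** * The two bounds on the limit *)

Local Open Scope classical_set_scope.
Local Open Scope ring_scope.

(* The two bounds are 8.4199 and 11.6569. *)
Theorem theorem11p1 (R : realType) :
  cvg (root_card_preim_Av321 R @ \oo) /\
  8 + 4199 / 10 ^+ 4 <= lim (root_card_preim_Av321 R @ \oo) <= 11 + 6569 / 10 ^+ 4.
Proof.
set lo := 8 + _; set hi := 11 + _; pose B : R := 1189 / 102.
have lo_ge0 : 0 <= lo by rewrite /lo; lra.
have hi_ge0 : 0 <= hi by rewrite /hi; lra.
have lt_lo : lo < 17 / 2 by rewrite /lo; lra.
have lt_hi : B < hi by rewrite /hi /B; lra.
have B_ge0 : 0 <= B by apply: divr_ge0; apply: ler0n.
have le_B n : (0 < n)%N -> (size (preim321 n))%:R <= 17 / 12 * B ^+ n.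
  exact: preim321_upper.
clearbody lo hi B.
have cvg_root : cvgn (root_card_preim_Av321 R).
  apply: (@supermul_cvg_root R (fun n => size (preim321 n)) (17 / 12 * B)).
  - exact: preim321_gt0.
  - exact: preim321_supermul.
  - move=> n n_gt0; apply: le_trans (le_B n n_gt0) _.
    (* The factor 17/12 moves into the base, as 17/12 <= (17/12)^n for n > 0. *)
    rewrite exprMn ler_wpM2r ?exprn_ge0 //.
    by rewrite -[leLHS]expr1; apply: ler_weXn2l => //; lra.
  - by apply: mulr_ge0 => //; lra.
split=> //; apply/andP; split.
  (* The constant (17/2)^21 accounts for the 21 letters of the completion. *)
  have [c c_gt0 def_c] : exists2 c : R, 0 < c & c = (17 / 2) ^+ 21.
    by exists ((17 / 2) ^+ 21) => //; apply: exprn_gt0; lra.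
  apply: limr_ge => //; near=> n.
  have n_gt0 : (0 < n)%N by near: n; exists 1%N.
  have len : (21 <= n)%N by near: n; exists 21%N.
  rewrite le_powR_root //.
  have c5_gt0 : 0 < c * 5 by rewrite mulr_gt0.
  rewrite -(ler_pM2l c5_gt0); apply: (@le_trans _ _ ((17 / 2) ^+ n)).
    by near: n; exact: near_geometric_le.
  have -> : (17 / 2) ^+ n = c * (17 / 2) ^+ (n - 21).
    by rewrite def_c -exprD subnKC.
  rewrite -mulrA ler_pM2l // expr_div_n ler_pdivrMr ?exprn_gt0 // mulrC.
  by have := preim321_lower (n - 21); rewrite subnK // -(ler_nat R) !natrM !natrX.
apply: limr_le => //; near=> n.
have n_gt0 : (0 < n)%N by near: n; exists 1%N.
rewrite powR_root_le //; apply: le_trans (le_B n n_gt0) _.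
near: n; exact: near_geometric_le.
Unshelve. all: by end_near. Qed.
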